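(* Let $L$ be the quantitative language of a mean-payoff automaton expression over alphabet $\Sigma$. If $\eta$ is an isolated cut-point of $L$, then the cut-point language $L^{\ge\eta}=\{w\in\Sigma^\omega\mid L(w)\ge\eta\}$ is $\omega$-regular.
   Context: A $\mathbb{Q}$-weighted automaton is $A=\langle Q,q_I,\Sigma,\delta,\mathsf{wt}\rangle$ with finite $Q$, initial $q_I$, total $\delta\subseteq Q\times\Sigma\times Q$, $\mathsf{wt}:\delta\to\mathbb{Q}$; deterministic means exactly one successor per state and letter. For the unique run on $w$ with weights $v_0v_1\dots$, a deterministic $\mathsf{LimInfAvg}$-automaton assigns $\liminf_n\frac1n\sum_{i<n}v_i$ and a $\mathsf{LimSupAvg}$-automaton $\limsup_n\frac1n\sum_{i<n}v_i$. A mean-payoff automaton expression is generated by $E::=A\mid\max(E,E)\mid\min(E,E)\mid\mathrm{sum}(E,E)$ with $A$ such deterministic automata, interpreted pointwise. A threshold $\eta\in\mathbb{R}$ is an isolated cut-point of $L$ if there exists $\epsilon>0$ with $|L(w)-\eta|>\epsilon$ for all $w\in\Sigma^\omega$. *)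

(* Defs.v *)
From HB Require Import structures.
From mathcomp Require Import all_boot all_order all_algebra.
From mathcomp Require Import all_classical all_reals all_analysis.
Set Implicit Arguments.
Unset Strict Implicit.
Unset Printing Implicit Defensive.
Import Order.TTheory GRing.Theory Num.Theory.
Local Open Scope classical_set_scope.
Local Open Scope ring_scope.

Definition omega_word (Sigma : Type) : Type := nat -> Sigma.

(* [wt] is given on all triples, but only its values on [delta] are ever used:
   see [run_is_run] below. *)
Record weighted_automaton (Sigma : finType) := WeightedAutomaton {
  wa_state :> finType;
  wa_init : wa_state;
  wa_delta : {set wa_state * Sigma * wa_state};
  wa_total : forall (q : wa_state) (a : Sigma),
    exists q' : wa_state, (q, a, q') \in wa_delta;
  wa_wt : wa_state * Sigma * wa_state -> rat
}.

Definition deterministic (Sigma : finType) (A : weighted_automaton Sigma) :=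
  forall (q : A) (a : Sigma), exists! q' : A, (q, a, q') \in wa_delta A.

Definition is_run (Sigma : finType) (A : weighted_automaton Sigma)
    (w : omega_word Sigma) (r : nat -> A) :=
  r 0%N = wa_init A /\ forall i, (r i, w i, r i.+1) \in wa_delta A.

(* By totality, the default value of [odflt] is never used. *)
Definition succ_state (Sigma : finType) (A : weighted_automaton Sigma)
    (q : A) (a : Sigma) : A :=
  odflt q [pick q' | (q, a, q') \in wa_delta A].

Fixpoint run (Sigma : finType) (A : weighted_automaton Sigma)
    (w : omega_word Sigma) (n : nat) : A :=
  if n is m.+1 then succ_state (run A w m) (w m) else wa_init A.

Lemma succ_stateP (Sigma : finType) (A : weighted_automaton Sigma)
    (q : A) (a : Sigma) : (q, a, succ_state q a) \in wa_delta A.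
Proof.
rewrite /succ_state; case: pickP => //= noq.
have [q' Hq'] := wa_total q a.
by have := noq q'; rewrite /= Hq'.
Qed.

Lemma run_is_run (Sigma : finType) (A : weighted_automaton Sigma)
    (w : omega_word Sigma) : is_run w (run A w).
Proof. by split=> // i; exact: succ_stateP. Qed.

Lemma run_unique (Sigma : finType) (A : weighted_automaton Sigma)
    (w : omega_word Sigma) (r : nat -> A) :
  deterministic A -> is_run w r -> r =1 run A w.
Proof.
move=> detA [r0 rS]; elim=> [//|i IHi] /=.
have [q' [_ uq']] := detA (r i) (w i).
by rewrite -(uq' _ (rS i)); apply: uq'; rewrite IHi; exact: succ_stateP.
Qed.

Definition run_weight (Sigma : finType) (A : weighted_automaton Sigma)
    (w : omega_word Sigma) (i : nat) : rat :=
  wa_wt (run A w i, w i, run A w i.+1).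

(* The term at n = 0 is 0 / 0 = 0, which affects neither limit below. *)
Definition average (R : realType) (v : nat -> rat) (n : nat) : R :=
  n%:R^-1 * \sum_(i < n) ratr (v i).

Inductive value_mode := LimInfAvg | LimSupAvg.

(* The averages of a run are bounded, since there are finitely many
   transitions; hence [limn_inf] and [limn_sup] are the usual finite limits
   inferior and superior. *)
Definition automaton_lang (R : realType) (Sigma : finType) (m : value_mode)
    (A : weighted_automaton Sigma) (w : omega_word Sigma) : R :=
  match m with
  | LimInfAvg => limn_inf (average R (run_weight A w))
  | LimSupAvg => limn_sup (average R (run_weight A w))
  end.

Inductive mp_expr (Sigma : finType) :=
| MpAtom (m : value_mode) (A : weighted_automaton Sigma) of deterministic A
| MpMax of mp_expr Sigma & mp_expr Sigma
| MpMin of mp_expr Sigma & mp_expr Sigma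
| MpSum of mp_expr Sigma & mp_expr Sigma.

Fixpoint mp_lang (R : realType) (Sigma : finType) (E : mp_expr Sigma)
    (w : omega_word Sigma) : R :=
  match E with
  | MpAtom m A _ => automaton_lang R m A w
  | MpMax E1 E2 => Num.max (mp_lang R E1 w) (mp_lang R E2 w)
  | MpMin E1 E2 => Num.min (mp_lang R E1 w) (mp_lang R E2 w)
  | MpSum E1 E2 => mp_lang R E1 w + mp_lang R E2 w
  end.

Definition isolated_cut_point (R : realType) (Sigma : finType)
    (L : omega_word Sigma -> R) (eta : R) :=
  exists2 eps : R, 0 < eps & forall w, `|L w - eta| > eps.

Definition cut_point_lang (R : realType) (Sigma : finType)
    (L : omega_word Sigma -> R) (eta : R) : set (omega_word Sigma) :=
  [set w | L w >= eta].

Record buchi_automaton (Sigma : finType) := BuchiAutomaton {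
  ba_state :> finType;
  ba_init : {set ba_state};
  ba_delta : {set ba_state * Sigma * ba_state};
  ba_acc : {set ba_state}
}.

Definition buchi_lang (Sigma : finType) (B : buchi_automaton Sigma) :
    set (omega_word Sigma) :=
  [set w | exists r : nat -> B,
    [/\ r 0%N \in ba_init B,
        forall i, (r i, w i, r i.+1) \in ba_delta B
      & forall n, exists2 k, (n <= k)%N & r k \in ba_acc B]].

(* Omega-regular languages are those of nondeterministic Buchi automata. *)
Definition omega_regular (Sigma : finType) (S : set (omega_word Sigma)) :=
  exists B : buchi_automaton Sigma, S = buchi_lang B.

(* Main.v *)
(* Run all atoms of E in parallel on one deterministic machine.  If the runs on
   w1 and w2 both visit a state q infinitely often, then L w1 and L w2 lie on
   the same side of the isolated cut-point: cut both runs into segments, turn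
   the segments into loops at q of a common length, and let x_j use in each
   group of N consecutive loops j loops of w2 and N - j loops of w1.  Then x_0
   and x_N have nearly the averages of w1 and w2, and x_j and x_{j+1} disagree
   with frequency 1/N; as L is Lipschitz in the limit averages of the atoms, a
   change of side would force a value close to the cut-point.  Hence L w >= eta
   holds iff the run on w visits infinitely often some state q that is visited
   infinitely often by a word of value >= eta, which is a deterministic Buchi
   condition. *)
Require Import Defs.
From mathcomp Require Import all_boot all_order all_algebra.
From mathcomp Require Import all_classical all_reals all_analysis.
From mathcomp Require Import ring lra zify.
Set Implicit Arguments.
Unset Strict Implicit.
Unset Printing Implicit Defensive.
Import Order.TTheory GRing.Theory Num.Theory.
Local Open Scope classical_set_scope.
Local Open Scope ring_scope.

(** * Comparing limits inferior and superior of bounded sequences *)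

Lemma bounded_funW (R : realType) (u : nat -> R) (M : R) :
  (forall n, `|u n| <= M) -> bounded_fun u.
Proof.
move=> uM; exists M; split; first exact: num_real.
by move=> x Mx n _; exact: le_trans (uM n) (ltW Mx).
Qed.

(** The index [m] may differ from [n], because later [u] and [v] are averages of words that run
    through corresponding blocks at different speeds. Each tail infimum of [v] lies below some [v m]
    close to [u n], so after subtracting [delta + e] it bounds a whole tail of [u] from below. *)
Lemma limn_inf_le_close (R : realType) (u v : nat -> R) (M delta : R) :
  (forall n, `|u n| <= M) -> (forall n, `|v n| <= M) ->
  (forall e K, 0 < e -> exists n0, forall n, (n0 <= n)%N ->
     exists2 m, (K <= m)%N & `|u n - v m| <= delta + e) ->
  limn_inf v <= limn_inf u + delta.
Proof.
move=> uM vM close.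
have bu := bounded_funW uM; have bv := bounded_funW vM.
rewrite [X in X <= _](limn_infE bv).
apply: ge_sup; first by exists (infs v 0%N), 0%N.
move=> _ [K _ <-]; apply/ler_addgt0Pr => e e0.
have [n0 Hn0] := close e K e0.
have lbv : infs v K - delta - e <= infs u n0.
  apply: lb_le_inf; first by exists (u n0), n0 => //=.
  move=> _ [n /= n0n <-].
  have [m Km] := Hn0 n n0n; rewrite ler_norml => /andP[uvm _].
  have : infs v K <= v m.
    apply: ge_inf; last by exists m.
    exact/has_lbound_sdrop/bounded_fun_has_lbound.
  lra.
have : infs u n0 <= limn_inf u.
  rewrite (limn_infE bu); apply: ub_le_sup; last by exists n0.
  exact: bounded_fun_has_ubound_infs.
lra.
Qed.

Lemma limn_sup_opp (R : realType) (u : nat -> R) (M : R) :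
  (forall n, `|u n| <= M) -> limn_sup u = - limn_inf (fun n => - u n).
Proof.
move=> uM; have uM' n : `|- u n| <= M by rewrite normrN.
rewrite (limn_supE (bounded_funW uM)) (limn_infE (bounded_funW uM')).
rewrite /inf; congr (- sup _).
rewrite (infsN u); apply/seteqP; split => [_ [_ [n _ <-] <-]|_ [n _ <-]].
  by exists n.
by exists (sups u n) => //; exists n.
Qed.

(** * Running means and block sums *)

Definition mean (R : realType) (u : nat -> R) (n : nat) : R :=
  n%:R^-1 * \sum_(i < n) u i.

Lemma ler_norm_sum_ord (R : realType) (u : nat -> R) (M : R) (n : nat) :
  (forall i, `|u i| <= M) -> `|\sum_(i < n) u i| <= n%:R * M.
Proof.
move=> uM; apply: (le_trans (ler_norm_sum _ _ _)).
apply: (@le_trans _ _ (\sum_(i < n) M)); first exact: ler_sum.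
by rewrite sumr_const card_ord mulr_natl.
Qed.

Lemma mean_le (R : realType) (u : nat -> R) (M : R) (n : nat) :
  (forall i, `|u i| <= M) -> `|mean u n| <= M.
Proof.
move=> uM; rewrite /mean; case: n => [|n].
  by rewrite big_ord0 mulr0 normr0; exact: le_trans (normr_ge0 _) (uM 0%N).
rewrite normrM normfV normr_nat ler_pdivrMl ?ltr0n//.
exact: ler_norm_sum_ord.
Qed.

Lemma sum_ord_shift (R : realType) (u : nat -> R) (t n : nat) :
  \sum_(i < t + n) u i = \sum_(i < t) u i + \sum_(i < n) u (t + i)%N.
Proof. by rewrite big_split_ord. Qed.

Definition block_sum (R : realType) (u : nat -> R) (t T k : nat) : R :=
  \sum_(i < T) u (t + k * T + i)%N.

Lemma sum_block_sum (R : realType) (u : nat -> R) (t T s : nat) :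
  \sum_(i < t + s * T) u i =
  \sum_(i < t) u i + \sum_(k < s) block_sum u t T k.
Proof.
elim: s => [|s IHs]; first by rewrite mul0n addn0 big_ord0 addr0.
by rewrite big_ord_recr /= addrA -IHs mulSnr addnA (sum_ord_shift u (_ + _)).
Qed.

(** The prefix of length [t] and the mismatch between [n] and the end of the last block cost at most
    [3 * t + T] terms; normalizing by [s * T] instead of [n] costs at most [t + T] more. *)
Lemma mean_block_sum (R : realType) (u : nat -> R) (M : R) (t T n s : nat) :
  (forall i, `|u i| <= M) -> (0 < T)%N -> (0 < s)%N ->
  (s * T <= n)%N -> (n <= s.+1 * T + t)%N ->
  `|mean u n - s%:R^-1 * \sum_(k < s) (block_sum u t T k / T%:R)| <=
  (4 * t + 2 * T)%:R * M / n%:R.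
Proof.
move=> uM T0 s0 sTn nsT.
have M0 : 0 <= M by exact: le_trans (normr_ge0 _) (uM 0%N).
have n0 : (0 < n)%N by apply: leq_trans sTn; rewrite muln_gt0 s0.
pose B := \sum_(k < s) block_sum u t T k.
have -> : \sum_(k < s) (block_sum u t T k / T%:R) = B / T%:R.
  by rewrite -mulr_suml.
have sumB := sum_block_sum u t T s.
have headM := @ler_norm_sum_ord _ u M t uM.
have BM : `|B| <= (s * T)%:R * M.
  rewrite /B; have -> : \sum_(k < s) block_sum u t T k =
      \sum_(i < s * T) u (t + i)%N.
    have := sum_ord_shift u t (s * T); rewrite sumB => /addrI; exact.
  by apply: (@ler_norm_sum_ord _ (fun i => u (t + i)%N)).
have diff : `|\sum_(i < n) u i - B| <= (3 * t + T)%:R * M.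
  (* Either at most [T] terms remain after the last full block, or the blocks overshoot [n], by at
     most [t] since [s * T <= n]. *)
  have [le|/ltnW le] := leqP (t + s * T) n.
    have Hn : n = (t + s * T + (n - (t + s * T)))%N by rewrite subnKC.
    rewrite Hn sum_ord_shift sumB -/B.
    have H := @ler_norm_sum_ord _ (fun i => u (t + s * T + i)%N) M
      (n - (t + s * T)) (fun i => uM _).
    have H' : (n - (t + s * T))%:R * M <= T%:R * M.
      by rewrite ler_wpM2r// ler_nat; lia.
    rewrite [X in `|X|](_ : _ = \sum_(i < t) u i +
      \sum_(i < n - (t + s * T)) u (t + s * T + i)%N); last by ring.
    apply: (le_trans (ler_normD _ _)).
    have H'' : 0 <= t%:R * M by rewrite mulr_ge0.
    rewrite natrD natrM mulrDl; lra.
  have Hn : (t + s * T = n + (t + s * T - n))%N by rewrite subnKC.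
  have H := @ler_norm_sum_ord _ (fun i => u (n + i)%N) M
      (t + s * T - n) (fun i => uM _).
  have H' : (t + s * T - n)%:R * M <= t%:R * M.
    by rewrite ler_wpM2r// ler_nat; lia.
  move: sumB; rewrite Hn sum_ord_shift -/B => sumB.
  rewrite [X in `|X|](_ : _ = \sum_(i < t) u i +
    - \sum_(i < t + s * T - n) u (n + i)%N); last by lra.
  apply: (le_trans (ler_normD _ _)); rewrite normrN.
  have H'' : 0 <= t%:R * M by rewrite mulr_ge0.
  have H3 : 0 <= T%:R * M by rewrite mulr_ge0.
  rewrite natrD natrM mulrDl; lra.
have n0' : 0 < n%:R :> R by rewrite ltr0n.
have s0' : 0 < s%:R :> R by rewrite ltr0n.
have T0' : 0 < T%:R :> R by rewrite ltr0n.
rewrite ler_pdivlMr// -[X in _ * X](@ger0_norm _ n%:R)// -normrM /mean.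
(* After multiplication by [n], the second term is the cost of the changed denominator; it is
   controlled by [BM] and [n - s * T <= t + T]. *)
rewrite [X in `|X|](_ : _ = (\sum_(i < n) u i - B) -
  (n%:R - s%:R * T%:R) / (s%:R * T%:R) * B); last first.
  by field; rewrite !gt_eqF.
apply: (le_trans (ler_normB _ _)).
have sTn' : s%:R * T%:R <= n%:R :> R by rewrite -natrM ler_nat.
have Hd : n%:R - s%:R * T%:R <= t%:R + T%:R :> R.
  by rewrite lerBlDr -natrM -!natrD ler_nat; lia.
have : `|(n%:R - s%:R * T%:R) / (s%:R * T%:R) * B| <= (t%:R + T%:R) * M.
  rewrite normrM normf_div (@ger0_norm _ (n%:R - _)) ?subr_ge0//.
  rewrite (@gtr0_norm _ (s%:R * T%:R)) ?mulr_gt0//.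
  apply: (@le_trans _ _ ((n%:R - s%:R * T%:R) / (s%:R * T%:R) *
      (s%:R * T%:R * M))).
    apply: ler_wpM2l; last by rewrite -natrM.
    by rewrite divr_ge0 ?subr_ge0// mulr_ge0.
  rewrite mulrA divfK; last by rewrite gt_eqF// mulr_gt0.
  exact: ler_wpM2r.
rewrite (natrD _ (3 * t)) (natrM _ 3) in diff.
rewrite (natrD _ (4 * t)) (natrM _ 4) (natrM _ 2); lra.
Qed.

Lemma exists_nat_gt (R : realType) (x : R) : exists n : nat, x < n%:R.
Proof.
exists (Num.truncn x).+1.
exact: truncnS_gt.
Qed.

(** After [s] blocks of each sequence both means are nearly averages of [s] block means, and those
    averages are close by hypothesis. So the mean of [u] at [n] is compared with that of [v] at
    [s * T'], where [s = n %/ T]. *)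
Lemma limn_inf_mean_le (R : realType) (u v : nat -> R) (M delta : R)
    (t t' T T' : nat) :
  (forall i, `|u i| <= M) -> (forall i, `|v i| <= M) ->
  (0 < T)%N -> (0 < T')%N ->
  (forall e, 0 < e -> exists s0, forall s, (s0 <= s)%N ->
    \sum_(k < s) `|block_sum u t T k / T%:R - block_sum v t' T' k / T'%:R| <=
    s%:R * (delta + e)) ->
  limn_inf (mean v) <= limn_inf (mean u) + delta.
Proof.
move=> uM vM T0 T'0 close.
have M0 : 0 <= M by exact: le_trans (normr_ge0 _) (uM 0%N).
apply: (@limn_inf_le_close _ _ _ M) => [n|n|e K e0]; try exact: mean_le.
have e30 : 0 < e / 3 by lra.
have [s0 Hs0] := close _ e30.
have [c Hc] := exists_nat_gt ((4 * t + 2 * T)%:R * M / (e / 3)).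
have [c' Hc'] := exists_nat_gt ((4 * t' + 2 * T')%:R * M / (e / 3)).
(* This forces [s] above [s0] and [K], and above [c] and [c'], which push each of the two boundary
   errors below [e / 3]. *)
exists (T * (s0 + K + c + c').+1)%N => n Hn.
pose s := (n %/ T)%N.
have sb : (s0 + K + c + c' < s)%N by rewrite /s leq_divRL// mulnC.
have s_gt0 : (0 < s)%N by lia.
have sT : (s * T <= n)%N by exact: leq_divM.
have nsT : (n < s.+1 * T)%N by rewrite -ltn_divLR.
have sn : (s <= n)%N by apply: leq_trans sT; rewrite leq_pmulr.
have ssT' : (s <= s * T')%N by rewrite leq_pmulr.
exists (s * T')%N; first by lia.
have small (x : R) (k m : nat) : 0 <= x -> x / (e / 3) < k%:R ->
    (k < m)%N -> x / m%:R <= e / 3.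
  move=> x0 xk km.
  rewrite ler_pdivrMr ?ltr0n; last by lia.
  rewrite mulrC -ler_pdivrMr//; apply: ltW; apply: lt_le_trans xk _.
  by rewrite ler_nat ltnW.
have H1 := @mean_block_sum _ u M t T n s uM T0 s_gt0 sT.
have {}H1 := H1 ltac:(lia).
have H2 := @mean_block_sum _ v M t' T' (s * T') s vM T'0 s_gt0 (leqnn _).
have {}H2 := H2 ltac:(lia).
have {}H1 := le_trans H1 (small _ _ n (mulr_ge0 (ler0n _ _) M0) Hc ltac:(lia)).
have {}H2 := le_trans H2
  (small _ _ (s * T')%N (mulr_ge0 (ler0n _ _) M0) Hc' ltac:(lia)).
have H3 : `|s%:R^-1 * \sum_(k < s) (block_sum u t T k / T%:R) -
    s%:R^-1 * \sum_(k < s) (block_sum v t' T' k / T'%:R)| <= delta + e / 3.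
  rewrite -mulrBr normrM normfV normr_nat ler_pdivrMl ?ltr0n//.
  rewrite -sumrB; apply: le_trans (ler_norm_sum _ _ _) _.
  by apply: Hs0; lia.
move: H1 H2 H3; rewrite !ler_norml; lra.
Qed.

(** The hypothesis is symmetric in the two sequences, which gives both inequalities for the limit
    inferior, and invariant under negation, which carries them over to the limit superior. *)
Lemma limn_mean_close (R : realType) (u v : nat -> R) (M delta : R)
    (t t' T T' : nat) :
  (forall i, `|u i| <= M) -> (forall i, `|v i| <= M) ->
  (0 < T)%N -> (0 < T')%N ->
  (forall e, 0 < e -> exists s0, forall s, (s0 <= s)%N ->
    \sum_(k < s) `|block_sum u t T k / T%:R - block_sum v t' T' k / T'%:R| <=
    s%:R * (delta + e)) ->
  `|limn_inf (mean u) - limn_inf (mean v)| <= delta /\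
  `|limn_sup (mean u) - limn_sup (mean v)| <= delta.
Proof.
move=> uM vM T0 T'0 close.
have inf_close (f g : nat -> R) : (forall i, `|f i| <= M) ->
    (forall i, `|g i| <= M) ->
    (forall e, 0 < e -> exists s0, forall s, (s0 <= s)%N ->
      \sum_(k < s) `|block_sum f t T k / T%:R - block_sum g t' T' k / T'%:R|
      <= s%:R * (delta + e)) ->
    `|limn_inf (mean f) - limn_inf (mean g)| <= delta.
  move=> fM gM fg; rewrite ler_distlC; apply/andP; split.
    rewrite lerBlDr; apply: (@limn_inf_mean_le _ _ _ M _ t' t T' T) => // e e0.
    have [s0 Hs0] := fg e e0; exists s0 => s /Hs0.
    by under eq_bigr do rewrite distrC.
  exact: (@limn_inf_mean_le _ _ _ M _ t t' T T').
split; first exact: inf_close.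
have meanN (f : nat -> R) : (fun n => - mean f n) = mean (fun i => - f i).
  by apply: funext => n; rewrite /mean sumrN mulrN.
have uM' n := @mean_le _ u M n uM; have vM' n := @mean_le _ v M n vM.
rewrite (limn_sup_opp uM') (limn_sup_opp vM') !meanN -opprD normrN.
apply: inf_close => [i|i|e e0]; rewrite ?normrN//.
have [s0 Hs0] := close e e0; exists s0 => s /Hs0.
apply: le_trans; apply: ler_sum => k _.
by rewrite /block_sum !sumrN !mulNr -opprD normrN.
Qed.

(** * Lipschitz dependence of values on the limit averages of one machine *)

Fixpoint mrun (Sigma P : Type) (step : P -> Sigma -> P) (p0 : P)
    (w : omega_word Sigma) (n : nat) : P :=
  if n is m.+1 then step (mrun step p0 w m) (w m) else p0.

Definition obs (R : realType) (Sigma P : Type) (step : P -> Sigma -> P)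
    (p0 : P) (f : P -> Sigma -> R) (w : omega_word Sigma) (i : nat) : R :=
  f (mrun step p0 w i) (w i).

(** Quantifying over all weight functions bounded by [M] lets one relation serve every atom of an
    expression at once. *)
Definition close_words (R : realType) (Sigma P : Type)
    (step : P -> Sigma -> P) (p0 : P) (M delta : R) (w w' : omega_word Sigma) :=
  forall f : P -> Sigma -> R, (forall p a, `|f p a| <= M) ->
  `|limn_inf (mean (obs step p0 f w)) - limn_inf (mean (obs step p0 f w'))|
    <= delta /\
  `|limn_sup (mean (obs step p0 f w)) - limn_sup (mean (obs step p0 f w'))|
    <= delta.

Definition visits_often (Sigma P : Type) (step : P -> Sigma -> P) (p0 q : P)
    (w : omega_word Sigma) :=
  forall n, exists2 k, (n <= k)%N & mrun step p0 w k = q.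

Lemma max_close (R : realType) (x y x' y' d d' : R) :
  `|x - x'| <= d -> `|y - y'| <= d' ->
  `|Num.max x y - Num.max x' y'| <= d + d'.
Proof.
rewrite !ler_norml => /andP[? ?] /andP[? ?].
by case: (lerP x y) => ?; case: (lerP x' y') => ?; apply/andP; split; lra.
Qed.

Lemma min_close (R : realType) (x y x' y' d d' : R) :
  `|x - x'| <= d -> `|y - y'| <= d' ->
  `|Num.min x y - Num.min x' y'| <= d + d'.
Proof.
rewrite !ler_norml => /andP[? ?] /andP[? ?].
by case: (lerP x y) => ?; case: (lerP x' y') => ?; apply/andP; split; lra.
Qed.

Definition lipschitz_on (R : realType) (Sigma P : Type)
    (step : P -> Sigma -> P) (p0 : P) (M c : R) (L : omega_word Sigma -> R) :=
  forall delta w w', close_words step p0 M delta w w' ->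
    `|L w - L w'| <= c * delta.

Lemma mrun_pair (Sigma P1 P2 : Type) (s1 : P1 -> Sigma -> P1)
    (s2 : P2 -> Sigma -> P2) p1 p2 (w : omega_word Sigma) (n : nat) :
  mrun (fun p a => (s1 p.1 a, s2 p.2 a)) (p1, p2) w n =
  (mrun s1 p1 w n, mrun s2 p2 w n).
Proof. by elim: n => //= n ->. Qed.

(** A weight function on one component, composed with the projection, is a weight function on the
    product that produces the same weights along every word. Hence closeness for the product implies
    closeness for each component. *)
Lemma lipschitz_on_pair (R : realType) (Sigma P1 P2 : Type)
    (s1 : P1 -> Sigma -> P1) (s2 : P2 -> Sigma -> P2) (p1 : P1) (p2 : P2)
    (M1 M2 c1 c2 : R) (L1 L2 L : omega_word Sigma -> R) :
  lipschitz_on s1 p1 M1 c1 L1 -> lipschitz_on s2 p2 M2 c2 L2 ->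
  (forall w w' d d', `|L1 w - L1 w'| <= d -> `|L2 w - L2 w'| <= d' ->
     `|L w - L w'| <= d + d') ->
  lipschitz_on (fun p a => (s1 p.1 a, s2 p.2 a)) (p1, p2)
    (Num.max M1 M2) (c1 + c2) L.
Proof.
move=> lip1 lip2 LL delta w w' close; rewrite mulrDl; apply: LL.
  apply: lip1 => f fM; have := close (fun p a => f p.1 a).
  have obsE : obs (fun p a => (s1 p.1 a, s2 p.2 a)) (p1, p2)
      (fun p a => f p.1 a) = obs s1 p1 f.
    by apply/funext => v; apply/funext => i; rewrite /obs mrun_pair.
  rewrite obsE; apply=> p a; rewrite le_max; apply/orP; left; exact: fM.
apply: lip2 => f fM; have := close (fun p a => f p.2 a).
have obsE : obs (fun p a => (s1 p.1 a, s2 p.2 a)) (p1, p2)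
    (fun p a => f p.2 a) = obs s2 p2 f.
  by apply/funext => v; apply/funext => i; rewrite /obs mrun_pair.
rewrite obsE; apply=> p a; rewrite le_max; apply/orP; right; exact: fM.
Qed.

Lemma mp_lang_lipschitz (R : realType) (Sigma : finType) (E : mp_expr Sigma) :
  exists (P : finType) (step : P -> Sigma -> P) (p0 : P) (M c : R),
    0 < c /\ lipschitz_on step p0 M c (mp_lang R E).
Proof.
have binary (E1 E2 : mp_expr Sigma) (L : omega_word Sigma -> R) :
  (exists (P : finType) (step : P -> Sigma -> P) (p0 : P) (M c : R),
    0 < c /\ lipschitz_on step p0 M c (mp_lang R E1)) ->
  (exists (P : finType) (step : P -> Sigma -> P) (p0 : P) (M c : R),
    0 < c /\ lipschitz_on step p0 M c (mp_lang R E2)) ->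
  (forall w w' d d', `|mp_lang R E1 w - mp_lang R E1 w'| <= d ->
    `|mp_lang R E2 w - mp_lang R E2 w'| <= d' -> `|L w - L w'| <= d + d') ->
  exists (P : finType) (step : P -> Sigma -> P) (p0 : P) (M c : R),
    0 < c /\ lipschitz_on step p0 M c L.
  move=> [P1 [s1 [p1 [M1 [c1 [c10 lip1]]]]]] [P2 [s2 [p2 [M2 [c2 [c20 lip2]]]]]].
  move=> LL; exists (P1 * P2)%type, (fun p a => (s1 p.1 a, s2 p.2 a)), (p1, p2).
  exists (Num.max M1 M2), (c1 + c2); split; first exact: addr_gt0.
  exact: lipschitz_on_pair lip1 lip2 LL.
elim: E => [m A detA|E1 IH1 E2 IH2|E1 IH1 E2 IH2|E1 IH1 E2 IH2] /=.
- pose f (q : A) (a : Sigma) : R := ratr (wa_wt (q, a, succ_state q a)).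
  exists A, (@succ_state Sigma A), (wa_init A).
  (* The sum of all absolute weights dominates each of them, and the constant is 1 because the value
     of an atom is itself one of the two limits. *)
  exists (\sum_(x : A * Sigma) `|f x.1 x.2|), 1; split => // delta w w' close.
  have runE v n : mrun (@succ_state Sigma A) (wa_init A) v n = run A v n.
    by elim: n => //= n ->.
  have avgE v : average R (run_weight A v) =
      mean (obs (@succ_state Sigma A) (wa_init A) f v).
    apply/funext => n; rewrite /average /mean; congr (_ * _).
    by apply: eq_bigr => i _; rewrite /obs runE.
  have [inf_close sup_close] : _ /\ _ := close f (fun p a => ltac:(
    rewrite (bigD1 (p, a)) //= lerDl; apply: sumr_ge0 => *; exact: normr_ge0)).
  by rewrite mul1r /automaton_lang; case: m; rewrite !avgE.
- by apply: binary IH1 IH2 _ => w w' d d'; exact: max_close.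
- by apply: binary IH1 IH2 _ => w w' d d'; exact: min_close.
- apply: binary IH1 IH2 _ => w w' d d' H1 H2.
  rewrite opprD addrACA; apply: le_trans (ler_normD _ _) _; exact: lerD.
Qed.

(** * Segments, loops and words assembled from blocks *)

Definition seg (Sigma : Type) (w : omega_word Sigma) (t n : nat) : seq Sigma :=
  mkseq (fun i => w (t + i)%N) n.

Lemma segS (Sigma : Type) (w : omega_word Sigma) (t n : nat) :
  seg w t n.+1 = rcons (seg w t n) (w (t + n)%N).
Proof. exact: mkseqS. Qed.

Fixpoint wsum (R : realType) (Sigma P : Type) (step : P -> Sigma -> P)
    (f : P -> Sigma -> R) (q : P) (s : seq Sigma) : R :=
  if s is a :: s' then f q a + wsum step f (step q a) s' else 0.

Lemma wsum_cat (R : realType) (Sigma P : Type) (step : P -> Sigma -> P)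
    (f : P -> Sigma -> R) (q : P) (s1 s2 : seq Sigma) :
  wsum step f q (s1 ++ s2) =
  wsum step f q s1 + wsum step f (foldl step q s1) s2.
Proof. by elim: s1 q => [|a s IH] q /=; rewrite ?add0r// IH addrA. Qed.

Lemma wsum_le (R : realType) (Sigma P : Type) (step : P -> Sigma -> P)
    (f : P -> Sigma -> R) (M : R) (q : P) (s : seq Sigma) :
  (forall p a, `|f p a| <= M) -> `|wsum step f q s| <= (size s)%:R * M.
Proof.
move=> fM; elim: s q => [|a s IH] q /=; first by rewrite normr0 mul0r.
by rewrite -add1n natrD mulrDl mul1r; apply: le_trans (ler_normD _ _) (lerD _ _).
Qed.

Lemma foldl_iter_loop (Sigma P : Type) (step : P -> Sigma -> P) (q : P)
    (c : seq Sigma) (m : nat) :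
  foldl step q c = q -> foldl step q (flatten (nseq m c)) = q.
Proof. by move=> cq; elim: m => //= m IH; rewrite foldl_cat cq. Qed.

Lemma wsum_iter_loop (R : realType) (Sigma P : Type) (step : P -> Sigma -> P)
    (f : P -> Sigma -> R) (q : P) (c : seq Sigma) (m : nat) :
  foldl step q c = q ->
  wsum step f q (flatten (nseq m c)) = m%:R * wsum step f q c.
Proof.
move=> cq; elim: m => /= [|m IH]; first by rewrite mul0r.
by rewrite wsum_cat cq IH -[in RHS]add1n natrD mulrDl mul1r.
Qed.

Lemma mrun_add (Sigma P : Type) (step : P -> Sigma -> P) (p0 : P)
    (w : omega_word Sigma) (t n : nat) :
  mrun step p0 w (t + n) = foldl step (mrun step p0 w t) (seg w t n).
Proof.
elim: n => [|n IH]; first by rewrite addn0.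
by rewrite segS foldl_rcons addnS /= IH.
Qed.

Lemma sum_obs_seg (R : realType) (Sigma P : Type) (step : P -> Sigma -> P)
    (p0 : P) (f : P -> Sigma -> R) (w : omega_word Sigma) (t n : nat) :
  \sum_(i < n) obs step p0 f w (t + i) =
  wsum step f (mrun step p0 w t) (seg w t n).
Proof.
elim: n => [|n IH]; first by rewrite big_ord0.
rewrite segS -cats1 wsum_cat /= addr0 big_ord_recr /= IH; congr (_ + _).
by rewrite /obs mrun_add.
Qed.

(** The common block length [T] locates a position by one division; if [T] is positive and all
    blocks have this size, the default [a0] is never read. *)
Definition block_word (Sigma : Type) (a0 : Sigma) (p : seq Sigma)
    (T : nat) (blk : nat -> seq Sigma) : omega_word Sigma :=
  fun i => if (i < size p)%N then nth a0 p i
           else nth a0 (blk ((i - size p) %/ T)%N) ((i - size p) %% T)%N.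

Lemma seg_block_word (Sigma : Type) (a0 : Sigma) (p : seq Sigma)
    (T : nat) (blk : nat -> seq Sigma) (k : nat) :
  (forall k, size (blk k) = T) ->
  seg (block_word a0 p T blk) (size p + k * T) T = blk k.
Proof.
move=> szT; apply: (@eq_from_nth _ a0); first by rewrite size_mkseq szT.
move=> i; rewrite size_mkseq => iT; rewrite nth_mkseq// /block_word.
rewrite -addnA ltnNge leq_addr /= addKn divnMDl ?(leq_ltn_trans _ iT)//.
by rewrite divn_small// addn0 modnMDl modn_small.
Qed.

Lemma seg_block_word_prefix (Sigma : Type) (a0 : Sigma) (p : seq Sigma)
    (T : nat) (blk : nat -> seq Sigma) :
  seg (block_word a0 p T blk) 0 (size p) = p.
Proof.
apply: (@eq_from_nth _ a0); first by rewrite size_mkseq.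
by move=> i; rewrite size_mkseq => ip; rewrite nth_mkseq// /block_word add0n ip.
Qed.

Lemma mrun_block_word (Sigma P : Type) (step : P -> Sigma -> P) (p0 q : P)
    (a0 : Sigma) (p : seq Sigma) (T : nat) (blk : nat -> seq Sigma) (k : nat) :
  foldl step p0 p = q -> (forall k, size (blk k) = T) ->
  (forall k, foldl step q (blk k) = q) ->
  mrun step p0 (block_word a0 p T blk) (size p + k * T) = q.
Proof.
move=> pq szT loop; elim: k => [|k IH].
  by rewrite mul0n addn0 -[size p]add0n mrun_add seg_block_word_prefix.
by rewrite mulSnr addnA mrun_add IH seg_block_word.
Qed.

(** Every block is a loop at [q], so its weight does not depend on its neighbours: loops taken from
    different words can be mixed freely. *)
Lemma block_sum_block_word (R : realType) (Sigma P : Type)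
    (step : P -> Sigma -> P) (f : P -> Sigma -> R) (p0 q : P)
    (a0 : Sigma) (p : seq Sigma) (T : nat) (blk : nat -> seq Sigma) (k : nat) :
  foldl step p0 p = q -> (forall k, size (blk k) = T) ->
  (forall k, foldl step q (blk k) = q) ->
  block_sum (obs step p0 f (block_word a0 p T blk)) (size p) T k =
  wsum step f q (blk k).
Proof.
move=> pq szT loop.
by rewrite /block_sum sum_obs_seg (mrun_block_word _ _ pq)// seg_block_word.
Qed.

(* Segments of length [l] are closed into loops at [q] by connecting paths, and
   each loop is repeated until it has the length [(l + C)`!], a common multiple
   of all loop lengths. *)
Lemma stretched_loops (R : realType) (Sigma P : Type) (step : P -> Sigma -> P)
    (p0 q : P) (w : omega_word Sigma) (t l C : nat) (cin cout : P -> seq Sigma) :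
  (forall p, (exists s, foldl step q s = p) -> foldl step q (cin p) = p) ->
  (forall p, (exists s, foldl step p s = q) -> foldl step p (cout p) = q) ->
  (forall p p', size (cin p) + size (cout p') <= C)%N ->
  mrun step p0 w t = q -> visits_often step p0 q w -> (0 < l)%N ->
  exists blk : nat -> seq Sigma, forall k,
    [/\ size (blk k) = (l + C)`!%N, foldl step q (blk k) = q &
        forall (f : P -> Sigma -> R) M, (forall p a, `|f p a| <= M) ->
          `|wsum step f q (blk k) / (l + C)`!%:R -
            block_sum (obs step p0 f w) t l k / l%:R| <= 2 * C%:R * M / l%:R].
Proof.
move=> cinP coutP cC wt often l0.
pose a k := mrun step p0 w (t + k * l)%N.
pose c k := cin (a k) ++ seg w (t + k * l) l ++ cout (a k.+1).
have aS k : foldl step (a k) (seg w (t + k * l) l) = a k.+1.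
  by rewrite /a mulSnr addnA -mrun_add.
(* The state [a k] is reachable from [q], which is visited at time [t], and it can reach [q], which
   is visited again later. *)
have cinA k : foldl step q (cin (a k)) = a k.
  by apply: cinP; exists (seg w t (k * l)); rewrite -wt -mrun_add.
have coutA k : foldl step (a k) (cout (a k)) = q.
  apply: coutP; have [m km <-] := often (t + k * l)%N.
  by exists (seg w (t + k * l) (m - (t + k * l))); rewrite -mrun_add subnKC.
have loop k : foldl step q (c k) = q by rewrite /c !foldl_cat cinA aS.
have szc k : size (c k) = (l + (size (cin (a k)) + size (cout (a k.+1))))%N.
  by rewrite /c !size_cat size_mkseq; lia.
exists (fun k => flatten (nseq ((l + C)`! %/ size (c k))%N (c k))) => k.
have cC' := cC (a k) (a k.+1).
(* The loop length is positive and at most [l + C]. *)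
have dvd : (size (c k) %| (l + C)`!)%N.
  by apply: dvdn_fact; rewrite szc addn_gt0 l0 /= leq_add2l.
split; last 1 first.
- move=> f M fM; rewrite wsum_iter_loop//.
  have M0 : 0 <= M by exact: le_trans (normr_ge0 _) (fM q (w 0%N)).
  set m := ((l + C)`! %/ size (c k))%N.
  have Hm : (l + C)`!%N = (m * size (c k))%N by rewrite divnK.
  have m0 : (0 < m)%N by move: (fact_gt0 (l + C)); rewrite Hm muln_gt0 => /andP[].
  have c0 : (0 < size (c k))%N by rewrite szc; lia.
  rewrite Hm natrM /block_sum sum_obs_seg -/(a k).
  set W := wsum step f q (c k); set S := wsum _ _ _ _.
  set n := size (c k).
  have WM : `|W| <= n%:R * M by exact: wsum_le.
  have WS : `|W - S| <= C%:R * M.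
    rewrite /W /c !wsum_cat cinA aS -/S.
    set x := wsum _ _ _ _; set y := wsum _ _ _ _.
    have -> : x + (S + y) - S = x + y by ring.
    apply: le_trans (ler_normD _ _) _.
    have Hx := wsum_le step q (cin (a k)) fM.
    have Hy := wsum_le step (a k.+1) (cout (a k.+1)) fM.
    apply: le_trans (lerD Hx Hy) _.
    by rewrite -mulrDl -natrD ler_wpM2r// ler_nat.
  have l0' : 0 < l%:R :> R by rewrite ltr0n.
  have n0' : 0 < n%:R :> R by rewrite ltr0n.
  have m0' : 0 < m%:R :> R by rewrite ltr0n.
  rewrite ler_pdivlMr// -[X in _ * X](@ger0_norm _ l%:R)// -normrM.
  (* The bound [2 * C * M] has two halves: the weight of the connecting paths, and the division by
     the loop length [n] instead of [l]. *)
  have -> : (m%:R * W / (m%:R * n%:R) - S / l%:R) * l%:R =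
      (W - S) - (n%:R - l%:R) / n%:R * W by field; rewrite !gt_eqF.
  apply: le_trans (ler_normB _ _) _.
  have ln : l%:R <= n%:R :> R by rewrite ler_nat /n szc leq_addr.
  have nC : n%:R - l%:R <= C%:R :> R.
    by rewrite lerBlDr -natrD ler_nat /n szc; lia.
  have : `|(n%:R - l%:R) / n%:R * W| <= C%:R * M.
    rewrite normrM normf_div (@ger0_norm _ (n%:R - _)) ?subr_ge0//.
    rewrite (@gtr0_norm _ n%:R)//.
    apply: (@le_trans _ _ ((n%:R - l%:R) / n%:R * (n%:R * M))).
      by apply: ler_wpM2l; rewrite // divr_ge0 ?subr_ge0.
    by rewrite mulrA divfK ?gt_eqF// ler_wpM2r.
  move: WS; lra.
- by rewrite size_flatten /shape map_nseq sumn_nseq mulnC divnK.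
- exact: foldl_iter_loop.
Qed.

(** * Interpolation between two words with a common recurrent state *)

(** Used to count the blocks in which consecutive interpolating words differ. Passing from [s] to
    [s.+1] raises the quotient exactly when [N] divides [s + N - j], that is, when [s %% N = j]. *)
Lemma sum_mod_eq (N j s : nat) : (j < N)%N ->
  (\sum_(k < s) (k %% N == j) = (s + (N.-1 - j)) %/ N)%N.
Proof.
move=> jN; have N0 : (0 < N)%N by exact: leq_ltn_trans jN.
elim: s => [|s IH]; first by rewrite big_ord0 divn_small//; lia.
rewrite big_ord_recr /= IH addSn divnS// addnC; congr (_ + _)%N.
have -> : (s + (N.-1 - j)).+1 = (s + N - j)%N by lia.
by rewrite -eqn_mod_dvd ?modnDr ?(modn_small jN)//; lia.
Qed.

(** If every state of [A] had a last visit, there would be no visit to [A] after the maximum of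
    these finitely many times. *)
Lemma visits_often_pigeonhole (P : finType) (A : {set P}) (r : nat -> P) :
  (forall n, exists2 k, (n <= k)%N & r k \in A) ->
  exists2 q, q \in A & forall n, exists2 k, (n <= k)%N & r k = q.
Proof.
move=> rA; apply: contrapT => noq.
have /choice[b Hb] : forall q, exists n, q \in A ->
    forall k, (n <= k)%N -> r k <> q.
  move=> q; case: (boolP (q \in A)) => [qA|_]; last by exists 0%N.
  apply: contrapT => Hq; apply: noq; exists q => // n.
  apply: contrapT => Hn; apply: Hq; exists n => _ k nk rk.
  by apply: Hn; exists k.
have [k bk rk] := rA (\max_q b q)%N.
apply: (Hb _ rk k) => //; apply: leq_trans bk.
exact: (leq_bigmax (r k)).
Qed.

Lemma interpolation (R : realType) (Sigma P : finType) (step : P -> Sigma -> P)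
    (p0 q : P) (w1 w2 : omega_word Sigma) (M delta : R) :
  0 < delta -> visits_often step p0 q w1 -> visits_often step p0 q w2 ->
  exists (N : nat) (x : nat -> omega_word Sigma),
    [/\ close_words step p0 M delta w1 (x 0%N),
        forall j, (j < N)%N -> close_words step p0 M delta (x j) (x j.+1) &
        close_words step p0 M delta (x N) w2].
Proof.
move=> delta0 often1 often2.
(* Connecting paths are fixed once per state, with the empty word where none exists; finiteness of
   [P] then bounds their lengths by [C]. *)
have /choice[cin cinP] : forall p, exists u,
    (exists s, foldl step q s = p) -> foldl step q u = p.
  move=> p; have [[u Hu]|no] := pselect (exists s, foldl step q s = p).
    by exists u.
  by exists [::].
have /choice[cout coutP] : forall p, exists u,
    (exists s, foldl step p s = q) -> foldl step p u = q.
  move=> p; have [[u Hu]|no] := pselect (exists s, foldl step p s = q).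
    by exists u.
  by exists [::].
pose C := (\max_p size (cin p) + \max_p size (cout p))%N.
have cC p p' : (size (cin p) + size (cout p') <= C)%N.
  apply: leq_add; first exact: (leq_bigmax (F := fun p => size (cin p)) p).
  exact: (leq_bigmax (F := fun p => size (cout p)) p').
(* Segments of length [l.+1] make the cost of closing them into loops at most [delta]; among [N.+1]
   residues, changing the blocks of one residue costs at most [delta]. *)
have [l Hl] := exists_nat_gt (2 * C%:R * M / delta).
have [N HN] := exists_nat_gt (2 * M / delta).
have [t1 _ wt1] := often1 0%N; have [t2 _ wt2] := often2 0%N.
have [blk1 Hblk1] := stretched_loops R cinP coutP cC wt1 often1 (ltn0Sn l).
have [blk2 Hblk2] := stretched_loops R cinP coutP cC wt2 often2 (ltn0Sn l).
set T := (l.+1 + C)`!%N in Hblk1 Hblk2.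
have T0 : (0 < T)%N by exact: fact_gt0.
(* [x j] and [x j.+1] differ only in the blocks [k] with [k %% N.+1 = j]. *)
pose b j k := if (k %% N.+1 < j)%N then blk2 k else blk1 k.
have szb j k : size (b j k) = T.
  by rewrite /b; case: ifP => _; [have [] := Hblk2 k|have [] := Hblk1 k].
have loopb j k : foldl step q (b j k) = q.
  by rewrite /b; case: ifP => _; [have [] := Hblk2 k|have [] := Hblk1 k].
pose p := seg w1 0 t1.
have pq : foldl step p0 p = q by rewrite -wt1 -[t1]add0n mrun_add.
(* All interpolating words keep the prefix of [w1], even the one compared with [w2]: a finite prefix
   affects no limit average. *)
pose x j := block_word (w1 0%N) p T (b j).
have xsum j (f : P -> Sigma -> R) k :
    block_sum (obs step p0 f (x j)) (size p) T k = wsum step f q (b j k).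
  exact: block_sum_block_word.
have ldelta : 2 * C%:R * M / l.+1%:R <= delta.
  rewrite ler_pdivrMr ?ltr0n// [delta * _]mulrC -ler_pdivrMr//; apply: ltW.
  by apply: lt_trans Hl _; rewrite ltr_nat.
have Ndelta : 2 * M / N.+1%:R <= delta.
  rewrite ler_pdivrMr ?ltr0n// [delta * _]mulrC -ler_pdivrMr//; apply: ltW.
  by apply: lt_trans HN _; rewrite ltr_nat.
have termwise (F : nat -> R) : (forall k, F k <= delta) -> forall e, 0 < e ->
    exists s0, forall s, (s0 <= s)%N -> \sum_(k < s) F k <= s%:R * (delta + e).
  move=> Fd e e0; exists 0%N => s _.
  apply: (@le_trans _ _ (\sum_(k < s) delta)); first exact: ler_sum.
  by rewrite sumr_const card_ord mulr_natl lerMn2r lerDl ltW ?orbT.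
exists N.+1, x; split=> [f fM|j jN f fM|f fM].
- apply: (@limn_mean_close _ _ _ M delta t1 (size p) l.+1 T) => //.
  + by move=> i; exact: fM.
  + by move=> i; exact: fM.
  + apply: (termwise (fun k =>
      `|block_sum (obs step p0 f w1) t1 l.+1 k / l.+1%:R -
        block_sum (obs step p0 f (x 0%N)) (size p) T k / T%:R|)) => k.
    rewrite xsum /b ltn0 distrC.
    by have [_ _ H] := Hblk1 k; exact: le_trans (H f M fM) ldelta.
- apply: (@limn_mean_close _ _ _ M delta (size p) (size p) T T) => //.
  + by move=> i; exact: fM.
  + by move=> i; exact: fM.
  + move=> e e0; have [s0 Hs0] := exists_nat_gt (2 * M / e).
    exists s0 => s s0s.
    have M0 : 0 <= M by exact: le_trans (normr_ge0 _) (fM q (w1 0%N)).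
    (* Only blocks of residue [j] contribute, each at most [2 * M] as a difference of two means
       bounded by [M]. *)
    apply: (@le_trans _ _ (\sum_(k < s) (2 * M) * (k %% N.+1 == j)%N%:R)).
      apply: ler_sum => k _; rewrite !xsum /b ltnS.
      case: (ltngtP (k %% N.+1)%N j) => [_|_|_]; rewrite ?subrr ?normr0 ?mulr0//.
      rewrite mulr1 -mulrBl normrM normfV normr_nat ler_pdivrMr ?ltr0n//.
      apply: le_trans (ler_normB _ _) _.
      have [sz1 _ _] := Hblk1 k; have [sz2 _ _] := Hblk2 k.
      have := wsum_le step q (blk1 k) fM; rewrite sz1.
      have := wsum_le step q (blk2 k) fM; rewrite sz2; lra.
    rewrite -mulr_sumr -natr_sum sum_mod_eq//.
    (* There are [D <= s / N.+1 + 1] such blocks. The main term is covered by [s * delta], the extra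
       block by [s * e] once [s] exceeds [2 * M / e]. *)
    set D := ((s + _) %/ _)%N.
    have HD : D%:R * N.+1%:R <= s%:R + N.+1%:R :> R.
      rewrite -natrM -natrD ler_nat; apply: leq_trans (leq_divM _ _) _.
      by rewrite leq_add2l /=; lia.
    have {}HD : D%:R <= s%:R / N.+1%:R + 1 :> R.
      by rewrite -(ler_pM2r (x := N.+1%:R)) ?ltr0n// mulrDl mul1r divfK// pnatr_eq0.
    have se : 2 * M <= s%:R * e.
      rewrite -ler_pdivrMr//; apply: ltW; apply: lt_le_trans Hs0 _.
      by rewrite ler_nat.
    have sd : s%:R * (2 * M / N.+1%:R) <= s%:R * delta by exact: ler_wpM2l.
    have := @ler_wpM2l _ (2 * M) ltac:(lra) _ _ HD.
    rewrite mulrDr mulr1 => /le_trans; apply; rewrite mulrDr.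
    by apply: lerD => //; rewrite mulrCA.
- apply: (@limn_mean_close _ _ _ M delta (size p) t2 T l.+1) => //.
  + by move=> i; exact: fM.
  + by move=> i; exact: fM.
  + apply: (termwise (fun k =>
      `|block_sum (obs step p0 f (x N.+1)) (size p) T k / T%:R -
        block_sum (obs step p0 f w2) t2 l.+1 k / l.+1%:R|)) => k.
    (* All residues are below [N.+1], so [x N.+1] uses only loops of [w2]. *)
    rewrite xsum /b ltn_mod /=.
    by have [_ _ H] := Hblk2 k; exact: le_trans (H f M fM) ldelta.
Qed.

(** * Isolated cut-points and the Buchi automaton *)

(** With [delta = eps / c], values at consecutive interpolating words differ by at most [eps]. A
    value above the cut-point exceeds it by more than [eps], so the next value cannot fall below
    it. *)
Lemma same_side_of_cut (R : realType) (Sigma P : finType)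
    (step : P -> Sigma -> P) (p0 q : P) (M c eta : R)
    (L : omega_word Sigma -> R) (w1 w2 : omega_word Sigma) :
  0 < c -> lipschitz_on step p0 M c L -> isolated_cut_point L eta ->
  visits_often step p0 q w1 -> visits_often step p0 q w2 ->
  eta <= L w1 -> eta <= L w2.
Proof.
move=> c0 lip [eps eps0 iso] often1 often2.
have close_side w w' : close_words step p0 M (eps / c) w w' ->
    eta <= L w -> eta <= L w'.
  move=> /lip; rewrite mulrC divfK ?gt_eqF// => ww' Lw.
  have := iso w; rewrite ger0_norm ?subr_ge0// => Lw_eps.
  by move: ww'; rewrite ler_norml; lra.
have [N [x [x0 xS xN]]] :=
  interpolation M (divr_gt0 eps0 c0) often1 often2.
move=> /(close_side _ _ x0) Lx0; apply: (close_side _ _ xN).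
have Lx j : (j <= N)%N -> eta <= L (x j).
  by elim: j => // j IH jN; exact: close_side (xS j jN) (IH (ltnW jN)).
exact: Lx.
Qed.

Theorem theorem7 (R : realType) (Sigma : finType) (E : mp_expr Sigma) (eta : R) :
  isolated_cut_point (mp_lang R E) eta ->
  omega_regular (cut_point_lang (mp_lang R E) eta).
Proof.
move=> iso; have [P [step [p0 [M [c [c0 lip]]]]]] := mp_lang_lipschitz R E.
pose good := [set q | `[< exists2 w, visits_often step p0 q w &
  eta <= mp_lang R E w >]]%SET.
(* The transitions are the graph of [step], so the only run on [w] is [mrun step p0 w]. *)
exists (BuchiAutomaton [set p0]%SET
  [set x : P * Sigma * P | x.2 == step x.1.1 x.1.2]%SET good).
apply/seteqP; split=> w /=.
  move=> Lw; exists (mrun step p0 w); split=> [|i|].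
  - by rewrite inE.
  - by rewrite inE.
  (* Some state recurs on [w], and [w] itself witnesses that this state is good. *)
  have [|q _ often] := @visits_often_pigeonhole _ [set: P]%SET (mrun step p0 w).
    by move=> n; exists n.
  move=> n; have [k nk rk] := often n; exists k => //.
  by rewrite rk inE; apply/asboolP; exists w.
move=> [r [r0 rS racc]].
have rE i : r i = mrun step p0 w i.
  elim: i => [|i IH] /=; first by move: r0; rewrite inE => /eqP.
  by have := rS i; rewrite inE /= IH => /eqP.
(* One good state recurs on [w]; the value of its witness [w'] lies above the cut-point, and so does
   that of [w]. *)
have [q] := visits_often_pigeonhole racc.
rewrite inE => /asboolP[w' often' Lw'] often.
have often_w : visits_often step p0 q w.
  by move=> n; have [k nk rk] := often n; exists k => //; rewrite -rE.
exact: same_side_of_cut c0 lip iso often' often_w Lw'.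
Qed.
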